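(* Let $K$ be a field. For every positive integer $p\ge 2$, there exists an unmixed bipartite graph $\mathcal H_p$ which is not a complete multipartite graph and which satisfies $v(J(\mathcal H_p))-\operatorname{bight}(I(\mathcal H_p))=p-2$. In particular, $v(J(\mathcal H_p))\ge\operatorname{bight}(I(\mathcal H_p))$.
   Context: Graphs are finite and simple. For a graph $G$ with vertex set $\{1,\ldots,u\}$ and edge set $E(G)$, in the polynomial ring $R=K[x_1,\ldots,x_u]$ with the standard grading, the edge ideal is $I(G)=\langle x_ix_j:(i,j)\in E(G)\rangle$ and the cover ideal is $J(G)=\bigcap_{(i,j)\in E(G)}\langle x_i,x_j\rangle$. For a homogeneous ideal $I$ of an $\mathbb N$-graded Noetherian ring $R=\bigoplus_n R_n$, the $v$-number is $v(I)=\min\{u:\text{there exist } f\in R_u\text{ and }\mathfrak p\in\operatorname{Ass}(R/I)\text{ with }\mathfrak p=(I:f)\}$. Also $\operatorname{bight}(I(G))=\max\{\operatorname{height}(Q):Q\in\operatorname{Ass}(R/I(G))\}$. A graph is unmixed if all its minimal vertex covers have the same cardinality. A graph $G$ is complete multipartite if $V(G)$ can be partitioned into sets $A_1,\ldots,A_k$ for some $k\ge2$ with $E(G)=\{(a,b):a\in A_i,\ b\in A_j,\ 1\le i,j\le k,\ i\ne j\}$. *)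

(* Defs.v *)
From mathcomp Require Import all_boot all_order all_algebra.
From mathcomp Require Import boolp classical_sets.
From mathcomp Require Import mpoly.
Set Implicit Arguments.
Unset Strict Implicit.
Unset Printing Implicit Defensive.
Import Order.TTheory GRing.Theory.

Local Open Scope classical_set_scope.
Local Open Scope ring_scope.

Section Ideals.
Variable R : comNzRingType.
Implicit Types (I P : set R) (f g : R).

Definition gen_ideal (S : set R) : set R :=
  [set g | exists r : seq (R * R),
      (forall t, t \in r -> S t.2) /\ g = \sum_(t <- r) t.1 * t.2].

Definition colon I f : set R := [set g | I (g * f)].

(* [idealr_closed] already requires 1 to lie outside the ideal. *)
Definition prime_ideal P : Prop :=
  idealr_closed (mem P) /\ prime_idealr_closed (mem P).

(* Ass(R/I): the annihilator of the class of f in R/I is (I : f). *)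
Definition Ass I : set (set R) :=
  [set P | prime_ideal P /\ exists f, P = colon I f].

(* Only the terms of index at most h of the sequence c are relevant. *)
Definition prime_chain P (h : nat) (c : nat -> set R) : Prop :=
  [/\ forall i, (i <= h)%N -> prime_ideal (c i),
      forall i, (i < h)%N -> c i `<` c i.+1
    & c h = P].

Definition is_height P (h : nat) : Prop :=
  (exists c, prime_chain P h c) /\
  (forall k c, prime_chain P k c -> (k <= h)%N).

(* In the maximum of the heights of the associated primes, the second clause
   asserts that every one of these heights is finite. *)
Definition is_bight I (b : nat) : Prop :=
  (exists2 P, Ass I P & is_height P b) /\
  (forall P, Ass I P -> exists2 h, is_height P h & (h <= b)%N).

Lemma is_height_uniq P h1 h2 : is_height P h1 -> is_height P h2 -> h1 = h2.
Proof.
move=> [[c1 H1] M1] [[c2 H2] M2].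
by apply/eqP; rewrite eqn_leq (M2 _ _ H1) (M1 _ _ H2).
Qed.

Lemma is_bight_uniq I b1 b2 : is_bight I b1 -> is_bight I b2 -> b1 = b2.
Proof.
move=> [[P1 A1 H1] M1] [[P2 A2 H2] M2]; apply/eqP; rewrite eqn_leq.
have [h1 /(is_height_uniq H1) <- ->] := M2 _ A1.
by have [h2 /(is_height_uniq H2) <- ->] := M1 _ A2.
Qed.

End Ideals.

Section VNumber.
Variables (K : fieldType) (n : nat).
Implicit Type I : set {mpoly K[n]}.

Definition v_degree I : set nat :=
  [set u | exists (f : {mpoly K[n]}) (P : set {mpoly K[n]}),
      [/\ f \is u.-homog, Ass I P & P = colon I f]].

Definition is_vnumber I (v : nat) : Prop :=
  v_degree I v /\ forall u, v_degree I u -> (v <= u)%N.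

Lemma is_vnumber_uniq I v1 v2 : is_vnumber I v1 -> is_vnumber I v2 -> v1 = v2.
Proof.
move=> [D1 M1] [D2 M2].
by apply/eqP; rewrite eqn_leq (M1 _ D2) (M2 _ D1).
Qed.

End VNumber.

Record sgraph (n : nat) := SGraph {
  adj :> rel 'I_n;
  adj_sym : ssrbool.symmetric adj;
  adj_irrefl : irreflexive adj
}.

Section Graphs.
Variables (n : nat) (G : sgraph n).

Definition vertex_cover (C : {set 'I_n}) : bool :=
  [forall i, forall j, G i j ==> (i \in C) || (j \in C)].

Definition unmixed : Prop :=
  forall C D, minset vertex_cover C -> minset vertex_cover D -> #|C| = #|D|.

Definition bipartite : Prop :=
  exists A : {set 'I_n}, forall i j, G i j -> (i \in A) != (j \in A).

Definition complete_multipartite : Prop :=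
  exists P : {set {set 'I_n}},
    [/\ finset.partition P [set: 'I_n]%SET, (2 <= #|P|)%N
      & forall i j, G i j <->
          exists A B, [/\ A \in P, B \in P, A != B, i \in A & j \in B]].

Variable K : fieldType.

Definition edge_ideal : set {mpoly K[n]} :=
  gen_ideal [set g | exists i j, G i j /\ g = 'X_i * 'X_j].

Definition cover_ideal : set {mpoly K[n]} :=
  [set g | forall i j, G i j -> gen_ideal [set 'X_i; 'X_j] g].

End Graphs.

Arguments edge_ideal {n} G K.
Arguments cover_ideal {n} G K.

(* Main.v *)
Require Import Defs.
From mathcomp Require Import all_boot all_order all_algebra.
From mathcomp Require Import boolp classical_sets.
From mathcomp Require Import mpoly fintype finset.

(* H_p is the blow-up of the path on four vertices, each vertex being replaced
   by p independent copies. Both I(G) and J(G) are intersections of primes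
   generated by variables: over the vertex covers of G for I(G), over the edges
   for J(G). The associated primes are those of the minimal sets, and (x_C) has
   height |C|: a chain below it extends by adjoining the other variables, and
   K[x_1, ..., x_n] has no chain of primes of length n + 1, for picking
   f_i in P_(i+1) but not in P_i, the f_i would be n + 1 algebraically
   independent polynomials, which a dimension count excludes. Minimal vertex
   covers of H_p contain exactly one end of each edge of a perfect matching, so
   they have 2p elements. If J(G) : f is the prime of the edge ab, some monomial
   of f involves every other neighbour of a or b, whence v(J(H_p)) >= 3p - 2,
   with equality at an edge joining an end block to the next one. *)

Set Implicit Arguments.
Unset Strict Implicit.
Unset Printing Implicit Defensive.
Import Order.TTheory GRing.Theory.
Local Open Scope classical_set_scope.
Local Open Scope ring_scope.

(** * Elementwise calculus of prime ideals *)

Lemma prime_idealP (R : comNzRingType) (P : set R) :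
  prime_ideal P <->
  [/\ P 0, ~ P 1, forall a u v, P u -> P v -> P (a * u + v)
    & forall u v, P (u * v) -> P u \/ P v].
Proof.
split=> [[[P0 P1 PD] PM]|[P0 P1 PD PM]].
  split=> [||a u v Pu Pv|u v Puv].
  - by move: P0; rewrite in_setE.
  - by move=> ?; case/negP: P1; rewrite in_setE.
  - by have := PD a u v; rewrite !in_setE; apply.
  - by have := PM u v; rewrite in_setE => /(_ Puv) /orP[]; rewrite in_setE; [left|right].
split; first split.
- by rewrite in_setE.
- by apply/negP; rewrite in_setE.
- by move=> a u v; rewrite !in_setE; apply: PD.
- by move=> u v; rewrite in_setE => /PM[]?; apply/orP; [left|right]; rewrite in_setE.
Qed.

Section PrimeIdeal.
Variables (R : comNzRingType) (P : set R).
Hypothesis primeP : prime_ideal P.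

Lemma prime_ideal0 : P 0. Proof. by case/prime_idealP: primeP. Qed.

Lemma prime_ideal1 : ~ P 1. Proof. by case/prime_idealP: primeP. Qed.

Lemma prime_idealD u v : P u -> P v -> P (u + v).
Proof. by case/prime_idealP: primeP => _ _ PD _ ? ?; rewrite -[u]mul1r; apply: PD. Qed.

Lemma prime_idealMl a u : P u -> P (a * u).
Proof.
by case/prime_idealP: primeP => P0 _ PD _ ?; rewrite -[X in P X]addr0; apply: PD.
Qed.

Lemma prime_ideal_sum (T : Type) (r : seq T) (S : pred T) (F : T -> R) :
  (forall t, S t -> P (F t)) -> P (\sum_(t <- r | S t) F t).
Proof. by move=> PF; apply: big_ind => //; [exact: prime_ideal0|exact: prime_idealD]. Qed.

Lemma prime_idealM u v : P (u * v) -> P u \/ P v.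
Proof. by case/prime_idealP: primeP => _ _ _; apply. Qed.

Lemma prime_idealX u k : P (u ^+ k) -> P u.
Proof.
by elim: k => [/prime_ideal1//|k IHk]; rewrite exprS => /prime_idealM[].
Qed.

Lemma prime_ideal_prod (T : finType) (S : pred T) (F : T -> R) :
  P (\prod_(t | S t) F t) -> exists2 t, S t & P (F t).
Proof.
move=> Pprod; apply: contrapT => noF; move: Pprod; apply: (big_ind (fun x => ~ P x)).
- exact: prime_ideal1.
- by move=> x y Px Py /prime_idealM[].
- by move=> t St PFt; apply: noF; exists t.
Qed.

End PrimeIdeal.

(** * Chains of primes in a polynomial ring in n variables *)

Section Dimension.
Variables (K : fieldType) (n : nat).
Local Notation R := {mpoly K[n]}.

(** For an ideal [P], this is linear independence over K of the classes of the [e i] in the quotient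
    by [P]. *)
Definition free_mod (P : set R) (I : finType) (e : I -> R) : Prop :=
  forall c : I -> K, P (\sum_i c i *: e i) -> forall i, c i = 0.

(* Reading the coefficients of a relation in increasing powers of f: once the
   lower ones vanish, a power of f cancels modulo P, and the lowest remaining
   coefficient lies in Q because f does. *)
Lemma free_mod_powers (P Q : set R) (I : finType) (e : I -> R) (f : R) (D : nat) :
    prime_ideal P -> prime_ideal Q -> P `<=` Q -> Q f -> ~ P f ->
    free_mod Q e ->
  free_mod P (fun ij : I * 'I_D => e ij.1 * f ^+ ij.2).
Proof.
move=> pP pQ PQ Qf Pf freee c Pc.
pose g (j : 'I_D) := \sum_i c (i, j) *: e i.
have {}Pc : P (\sum_j g j * f ^+ j).
  rewrite (_ : \sum_j _ = \sum_ij c ij *: (e ij.1 * f ^+ ij.2)) //.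
  rewrite [RHS](eq_bigr (fun p => c (p.1, p.2) *: (e p.1 * f ^+ p.2))); last by case.
  rewrite -(pair_bigA _ (fun i j => c (i, j) *: (e i * f ^+ nat_of_ord j))) /=.
  rewrite exchange_big /=; apply: eq_bigr => j _.
  by rewrite mulr_suml; apply: eq_bigr => i _; rewrite scalerAl.
suff c0 k : forall i (j : 'I_D), (j < k)%N -> c (i, j) = 0.
  by case=> i j; apply: (c0 j.+1).
elim: k => // k IHk i j; rewrite ltnS leq_eqVlt => /orP[/eqP jk|/IHk//].
move: i; apply: freee; rewrite -/(g j).
have g0 (l : 'I_D) : (l < k)%N -> g l = 0.
  by move=> lk; apply: big1 => i _; rewrite IHk ?scale0r.
have Pk : P (f ^+ j * \sum_(l : 'I_D | (j <= l)%N) g l * f ^+ (l - j)).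
  rewrite (_ : _ * _ = \sum_l g l * f ^+ l) // [RHS](bigID (fun l : 'I_D => (j <= l)%N)) /=.
  rewrite [X in _ = _ + X]big1 ?addr0 => [|l]; last by rewrite -ltnNge jk => /g0->; rewrite mul0r.
  rewrite mulr_sumr; apply: eq_bigr => l jl.
  by rewrite mulrCA -exprD subnKC.
case: (prime_idealM pP Pk) => [/(prime_idealX pP)//|/PQ].
rewrite (bigD1 j) //= subnn expr0 mulr1 => Qs.
rewrite -[g j](addrK (\sum_(l : 'I_D | (j <= l)%N && (l != j)) g l * f ^+ (l - j))).
apply: (prime_idealD pQ) => //; rewrite -mulN1r; apply: (prime_idealMl pQ).
apply: (prime_ideal_sum pQ) => l /andP[jl lj].
have jl1 : (j < l)%N by rewrite ltn_neqAle jl eq_sym lj.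
by rewrite -(prednK (_ : 0 < l - j)%N) ?subn_gt0 // exprSr mulrA; apply: prime_idealMl.
Qed.

Lemma msizeMX_le (p f : R) j : (msize (p * f ^+ j)%R <= msize p + msize f * j)%N.
Proof.
elim: j => [|j IHj]; first by rewrite expr0 mulr1 leq_addr.
rewrite exprSr mulrA mulnS.
have [->|p0] := eqVneq (p * f ^+ j) 0; first by rewrite mul0r msize0.
have [->|f0] := eqVneq f 0; first by rewrite mulr0 msize0.
rewrite msizeM // (leq_trans (leq_pred _)) //.
by rewrite addnCA addnC leq_add2l.
Qed.

Lemma card_bmultinom s : (#|{: 'X_{1..n < s}}| <= s ^ n)%N.
Proof.
have mlt (m : 'X_{1..n < s}) i : (bmnm m i < s)%N.
  by rewrite (leq_ltn_trans _ (bmdeg m)) // mdegE (bigD1 i) //= leq_addr.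
rewrite -[s in (s ^ _)%N]card_ord -[n in (_ ^ n)%N]card_ord -card_ffun.
apply: (leq_card (fun m : 'X_{1..n < s} => [ffun i => Ordinal (mlt m i)])).
move=> m1 m2 /ffunP eqm; apply/val_inj/mnmP => i /=.
by have := eqm i; rewrite !ffunE => -[].
Qed.

(** Since 0 lies in [P], independence modulo [P] implies independence over K. The coefficient
    matrix, with columns the monomials of degree below [s], thus has independent rows, so at least
    as many columns as rows. *)
Lemma free_mod_card (P : set R) (I : finType) (e : I -> R) s :
    P 0 -> free_mod P e -> (forall i, (msize (e i) <= s)%N) -> (#|I| <= s ^ n)%N.
Proof.
move=> P0 freee szs; apply: leq_trans (card_bmultinom s).
pose M : 'M[K]_(#|I|, #|{: 'X_{1..n < s}}|) :=
  \matrix_(i, j) (e (enum_val i))@_(@enum_val 'X_{1..n < s} predT j).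
suff : row_free M by rewrite -row_leq_rank => /leq_trans; apply; exact: rank_leq_col.
apply: inj_row_free => v vM0; apply/rowP => i; rewrite mxE.
rewrite -[i]enum_valK; move: (enum_val i) => {}i.
apply: (freee (fun i => v 0 (enum_rank i))).
suff -> : \sum_i v 0 (enum_rank i) *: e i = 0 by [].
apply/mpolyP => m; rewrite mcoeff0 raddf_sum /=.
have [ms|sm] := ltnP (mdeg m) s.
  have := congr1 (fun w : 'rV_ _ => w 0 (enum_rank (BMultinom ms))) vM0.
  rewrite !mxE => vM; apply: etrans vM; rewrite (reindex (@enum_val I predT)) /=; last first.
    by apply: onW_bij; apply: enum_val_bij.
 by apply: eq_bigr => k _; rewrite enum_valK mcoeffZ !mxE enum_rankK.
apply: big1 => k _; rewrite mcoeffZ memN_msupp_eq0 ?mulr0 //.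
by apply: msize_mdeg_ge; apply: leq_trans sm.
Qed.

(** Going down the chain from the family consisting of 1, each strict inclusion supplies an f, and
    the family is multiplied by the powers of f with exponent below D. The cardinality gains a
    factor D at each step, while the degrees stay linear in D. *)
Lemma prime_chain_free (P : set R) h c : prime_chain P h c ->
  exists M, forall D, exists (I : finType) (e : I -> R),
    [/\ #|I| = (D ^ h)%N, free_mod (c 0%N) e
      & forall i, (msize (e i) <= 1 + M * D)%N].
Proof.
case=> pc ltc _.
suff H k : (k <= h)%N -> exists M, forall D, exists (I : finType) (e : I -> R),
    [/\ #|I| = (D ^ k)%N, free_mod (c (h - k)%N) e
      & forall i, (msize (e i) <= 1 + M * D)%N].
  by have := H h (leqnn h); rewrite subnn.
elim: k => [_|k IHk kh].
  exists 0%N => D; exists unit, (fun _ => 1); split; first by rewrite card_unit.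
    move=> a; rewrite subn0 (big_pred1 tt) => [Pa []|[]//].
    apply/eqP; apply: contra_notT (prime_ideal1 (pc h (leqnn _))) => a0.
    have := prime_idealMl (pc h (leqnn _)) ((a tt)^-1)%:MP Pa.
    by rewrite mul_mpolyC scalerA mulVf // scale1r.
  by move=> i; rewrite msize1.
have [M HM] := IHk (ltnW kh).
have /ltc : (h - k.+1 < h)%N by rewrite ltn_subrL (leq_ltn_trans _ kh).
rewrite -subSn // subSS => -[sPQ /existsNP[f /not_implyP[Qf Pf]]].
exists (M + msize f)%N => D; have [I [e [cI freee sze]]] := HM D.
exists (I * 'I_D)%type, (fun ij : I * 'I_D => e ij.1 * f ^+ ij.2); split.
- by rewrite card_prod cI card_ord expnSr.
- by apply: free_mod_powers sPQ Qf Pf freee; apply: pc; rewrite leq_subr.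
- move=> [i j] /=; rewrite (leq_trans (msizeMX_le _ _ _)) // mulnDl addnA.
  by rewrite leq_add ?sze // leq_mul2l ltnW ?orbT.
Qed.

Lemma prime_chain_le (P : set R) h c : prime_chain P h c -> (h <= n)%N.
Proof.
move=> chc; have [M HM] := prime_chain_free chc.
rewrite leqNgt; apply/negP => nh.
(* With this D, (1 + M D)^n <= (M + 1)^n D^n < D^(n+1) <= D^h when n < h, against the bound of
   [free_mod_card]. *)
pose D := (M.+1 ^ n).+1; have [I [e [cI freee sze]]] := HM D.
have P0 : c 0%N 0 by case: chc => pc _ _; apply: prime_ideal0; apply: pc.
have := free_mod_card P0 freee sze; rewrite cI leqNgt => /negP; apply.
have le1 : (1 + M * D <= M.+1 * D)%N by rewrite mulSn leq_add2r.
have leX : ((1 + M * D) ^ n <= (M.+1 * D) ^ n)%N by case: (n) => // m; rewrite leq_exp2r.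
apply: leq_ltn_trans leX _; rewrite expnMn.
apply: (@leq_trans (D ^ n.+1)); last by rewrite leq_pexp2l.
by rewrite expnS ltn_pmul2r ?expn_gt0.
Qed.
End Dimension.

(** * Primes generated by variables and their heights *)

Section VarIdeal.
Variables (K : fieldType) (n : nat).
Local Notation R := {mpoly K[n]}.
Implicit Types (C : {set 'I_n}) (m : 'X_{1..n}) (f g : R).

Definition hits m C : bool := [exists i in C, (0 < m i)%N].

Lemma hitsS m C C' : C \subset C' -> hits m C -> hits m C'.
Proof.
by move=> /subsetP sC /exists_inP[i Ci mi]; apply/exists_inP; exists i; rewrite ?sC.
Qed.

(** A monomial ideal contains a polynomial exactly when it contains each of its monomials, so this
    is the ideal generated by the variables in [C]. *)
Definition var_ideal C : set R := [set g | forall m, m \in msupp g -> hits m C].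

Definition kill C g : R := g \mPo [tuple if i \in C then 0 else 'X_i | i < n].

Lemma kill_monomial C m : kill C 'X_[m] = if hits m C then 0 else 'X_[m].
Proof.
rewrite /kill comp_mpolyX; case: ifPn => [/exists_inP[i Ci mi]|/exists_inPn mC].
  by rewrite (bigD1 i) //= tnth_mktuple Ci expr0n eqn0Ngt mi mul0r.
rewrite [RHS]mpolyXE_id; apply: eq_bigr => i _; rewrite tnth_mktuple.
by case: ifPn => // /mC; rewrite -eqn0Ngt => /eqP->; rewrite !expr0.
Qed.

Lemma mcoeff_kill C g m : (kill C g)@_m = if hits m C then 0 else g@_m.
Proof.
rewrite /kill comp_mpolyEX raddf_sum /= [in RHS](mpolyE g) raddf_sum /=.
case: ifPn => mC; [apply: big1 => k _ | apply: eq_bigr => k _];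
  rewrite !mcoeffZ -/(kill C _) kill_monomial; case: ifPn => kC //;
  rewrite ?mcoeff0 ?mcoeffX ?mulr0 //; case: eqVneq => [ekm|]; rewrite ?mulr0 //.
- by rewrite ekm mC in kC.
- by rewrite ekm (negbTE mC) in kC.
Qed.

Lemma var_ideal_kill C g : var_ideal C g <-> kill C g = 0.
Proof.
split=> [Cg|g0 m].
  apply/mpolyP => m; rewrite mcoeff_kill mcoeff0; case: ifPn => // mC.
  by apply: memN_msupp_eq0; apply: contra mC; apply: Cg.
by rewrite mcoeff_msupp; apply: contraNT => mC; rewrite -(mcoeff0 _ m) -g0 mcoeff_kill (negbTE mC).
Qed.

(** The ideal is the kernel of the substitution [kill C], a ring morphism into a domain. *)
Lemma var_ideal_prime C : prime_ideal (var_ideal C).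
Proof.
apply/prime_idealP; split.
- by apply/var_ideal_kill; rewrite /kill comp_mpoly0.
- by move/var_ideal_kill; rewrite /kill comp_mpoly1 => /eqP; rewrite oner_eq0.
- move=> a u v /var_ideal_kill u0 /var_ideal_kill v0; apply/var_ideal_kill.
  by move: u0 v0; rewrite /kill rmorphD rmorphM /= => -> ->; rewrite mulr0 addr0.
- move=> u v /var_ideal_kill /eqP; rewrite /kill rmorphM /= mulf_eq0.
  by case/orP => /eqP; [left|right]; apply/var_ideal_kill.
Qed.

Lemma var_ideal_monomial C m : var_ideal C 'X_[m] <-> hits m C.
Proof.
split=> [|mC k]; first by apply; rewrite msuppX mem_head.
by rewrite msuppX mem_seq1 => /eqP->.
Qed.

Lemma var_idealX C i : var_ideal C 'X_i <-> i \in C.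
Proof.
rewrite var_ideal_monomial; split=> [/exists_inP[j Cj]|Ci].
  by rewrite mnm1E; case: eqVneq => // ->.
by apply/exists_inP; exists i; rewrite // mnm1E eqxx.
Qed.

Lemma var_idealS C C' : var_ideal C `<=` var_ideal C' <-> C \subset C'.
Proof.
split=> [sC|sC g Cg m mg]; last exact: hitsS sC (Cg m mg).
by apply/subsetP => i /var_idealX /sC /var_idealX.
Qed.

Lemma prime_chain_extend (P Q : set R) h c :
  prime_chain P h c -> prime_ideal Q -> P `<` Q ->
  prime_chain Q h.+1 (fun i => if (i <= h)%N then c i else Q).
Proof.
move=> [pc ltc ch] pQ PQ; split.
- by move=> i ih; case: leqP => // /pc.
- move=> i; rewrite ltnS => ih; rewrite ih.
  by case: ltngtP ih => // [ih|->] _; [apply: ltc|rewrite ch].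
- by rewrite ltnn.
Qed.

Lemma var_ideal_ltU1 C i : i \notin C -> var_ideal C `<` var_ideal (i |: C).
Proof.
move=> iC; split; first exact/var_idealS/subsetUr.
by move/var_idealS/subsetP/(_ i); rewrite setU11 (negbTE iC) => /(_ isT).
Qed.

(** Induction on the number of variables outside [C]: adjoining one of them raises both h and the
    size of [C] by one. Once all variables are present, the bound is [prime_chain_le]. *)
Lemma var_ideal_chain_le C h c : prime_chain (var_ideal C) h c -> (h <= #|C|)%N.
Proof.
have [k] := ubnP (#|~: C|); elim: k C h c => // k IHk C h c Ck chc.
have [CT|] := eqVneq C setT.
  by rewrite CT cardsT card_ord; apply: prime_chain_le chc.
rewrite -subTset => /subsetPn[i _ iC].
have := prime_chain_extend chc (var_ideal_prime _) (var_ideal_ltU1 iC).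
move/IHk; rewrite cardsU1 iC; apply.
rewrite -ltnS; apply: leq_trans Ck; rewrite ltnS; apply: proper_card; rewrite properE setCS subsetUr /=.
by apply/subsetPn; exists i; rewrite !inE ?iC ?eqxx.
Qed.

Lemma var_ideal_height C : is_height (var_ideal C) #|C|.
Proof.
split; last exact: var_ideal_chain_le.
have [k] := ubnP #|C|; elim: k C => // k IHk C Ck.
have [->|] := set_0Vmem C.
  by exists (fun=> var_ideal set0); rewrite cards0; split=> // *; apply: var_ideal_prime.
case=> i Ci; have Ci1 : i \notin C :\ i by rewrite !inE eqxx.
rewrite (cardsD1 i) Ci add1n ltnS in Ck *.
have [c chc] := IHk _ Ck.
have := prime_chain_extend chc (var_ideal_prime _) (var_ideal_ltU1 Ci1).
by rewrite setD1K //; eexists; eassumption.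
Qed.

End VarIdeal.
Arguments var_ideal : clear implicits.
Arguments var_ideal K {n} C.

(** * Colon ideals and associated primes of intersections of such primes *)

Section InterIdeal.
Variables (K : fieldType) (n : nat).
Local Notation R := {mpoly K[n]}.
Local Notation var_ideal := (@var_ideal K n).
Implicit Types (C S : {set 'I_n}) (F : {set {set 'I_n}}) (m : 'X_{1..n}) (f g : R).

Definition inter_ideal F : set R := [set g | forall C, C \in F -> var_ideal C g].

(** Members of the intersection that contain f impose no condition on the colon ideal, and the
    others all contain the ideal of [C]. *)
Lemma colon_inter_ideal F f C :
    C \in F -> ~ var_ideal C f ->
    (forall C', C' \in F -> ~ var_ideal C' f -> C \subset C') ->
  colon (inter_ideal F) f = var_ideal C.
Proof.
move=> FC Cf minC; apply/seteqP; split=> [g /(_ C FC)|g Cg C' FC'].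
  by case/(prime_idealM (var_ideal_prime K C)).
have [C'f|C'f] := pselect (var_ideal C' f).
  exact: prime_idealMl (var_ideal_prime K C') _ _ C'f.
rewrite mulrC; apply: prime_idealMl (var_ideal_prime K C') _ _ _.
by move: g Cg; apply/var_idealS/minC.
Qed.

(** The colon ideal is the intersection of the finitely many primes that miss f; being prime, it
    must contain one of them, which is then the least. *)
Lemma prime_colon_inter_ideal F f :
    prime_ideal (colon (inter_ideal F) f) ->
  exists C, [/\ C \in F, ~ var_ideal C f
              & forall C', C' \in F -> ~ var_ideal C' f -> C \subset C'].
Proof.
set P := colon _ _ => pP.
have PC C : C \in F -> ~ var_ideal C f -> P `<=` var_ideal C.
  by move=> FC Cf g /(_ C FC) /(prime_idealM (var_ideal_prime K C))[].
suff [C [FC Cf CP]] : exists C, [/\ C \in F, ~ var_ideal C f & var_ideal C `<=` P].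
  exists C; split=> // C' FC' C'f; apply/(var_idealS K) => g /CP; exact: PC.
apply: contrapT => noC.
have /choice[g gP] C : exists g, var_ideal C g /\ (C \in F -> ~ var_ideal C f -> ~ P g).
  have [Cf|Cf] := pselect (C \in F /\ ~ var_ideal C f); last first.
    exists 0; split; first exact: prime_ideal0 (var_ideal_prime K C).
    by move=> FC Cf'; case: Cf.
  have /existsNP[g /not_implyP[Cg Pg]] : ~ (var_ideal C `<=` P).
    by move=> CP; apply: noC; exists C; case: Cf.
  by exists g.
(* If no such prime lies in [P], each has an element outside [P]. The product of these elements lies
   in all of them, hence in [P], which contradicts primality. *)
have : P (\prod_(C | (C \in F) && ~~ `[<var_ideal C f>]) g C).
  move=> C FC; have [Cf|Cf] := pselect (var_ideal C f).
    exact: prime_idealMl (var_ideal_prime K C) _ _ Cf.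
  rewrite (bigD1 C) /=; last by rewrite FC; apply/negP => /asboolP.
  rewrite mulrAC mulrC; apply: (prime_idealMl (var_ideal_prime K C)).
  rewrite mulrC; apply: (prime_idealMl (var_ideal_prime K C)); exact: (gP C).1.
case/(prime_ideal_prod pP) => C /andP[FC Cf].
by apply: (gP C).2 => //; apply/asboolPn.
Qed.

Definition set_monomial S : 'X_{1..n} := [multinom nat_of_bool (i \in S) | i < n].

Lemma set_monomialE S i : set_monomial S i = (i \in S) :> nat.
Proof. exact: mnmE. Qed.

Lemma hits_set_monomial S C : hits (set_monomial S) C = ~~ [disjoint S & C]%B.
Proof.
rewrite disjoint_sym disjoint_subset.
by apply/exists_inP/subsetPn => -[i Ci]; rewrite ?set_monomialE ?inE => Si;
  exists i; rewrite ?set_monomialE ?inE //; case: (i \in S) Si.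
Qed.

Lemma mdeg_set_monomial S : mdeg (set_monomial S) = #|S|.
Proof.
rewrite mdegE -sum1_card [RHS]big_mkcond; apply: eq_bigr => i _.
by rewrite set_monomialE; case: (i \in S).
Qed.

Lemma var_ideal_set_monomial S C :
  var_ideal C 'X_[set_monomial S] <-> ~~ [disjoint S & C]%B.
Proof. by rewrite var_ideal_monomial hits_set_monomial. Qed.

Lemma colon_inter_ideal_monomial F C S :
    C \in F -> [disjoint S & C]%B ->
    (forall C', C' \in F -> [disjoint S & C']%B -> C \subset C') ->
  colon (inter_ideal F) 'X_[set_monomial S] = var_ideal C.
Proof.
move=> FC SC minC; apply: colon_inter_ideal => // [|C' FC'].
  by move/var_ideal_set_monomial; rewrite SC.
by move=> SC'; apply: minC => //; apply: contra_notT SC' => /var_ideal_set_monomial.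
Qed.

Lemma Ass_inter_ideal F (P : set R) :
  Ass (inter_ideal F) P <-> exists2 C, minset (mem F) C & P = var_ideal C.
Proof.
split=> [[pP [f defP]]|[C /minsetP[FC minC] ->]].
  rewrite {}defP in pP *; have [C [FC Cf minC]] := prime_colon_inter_ideal pP.
  exists C; last exact: colon_inter_ideal.
  apply/minsetP; split=> // C' FC' C'C; apply/eqP; rewrite eqEsubset C'C /=.
  by apply: minC => // C'f; apply: Cf; exact: (var_idealS K C' C).2 C'f.
split; first exact: var_ideal_prime.
(* The product of the variables outside [C] avoids the ideal of [C'] only if [C'] is contained in
   [C], that is, only for [C] itself by minimality. *)
exists 'X_[set_monomial (~: C)]; rewrite (colon_inter_ideal_monomial FC) //.
  by rewrite disjoint_sym disjoints_subset setCK.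
by move=> C' FC'; rewrite disjoint_sym disjoints_subset setCK => /(minC _ FC')->.
Qed.

Lemma v_degree_inter_ideal F C S :
    C \in F -> [disjoint S & C]%B ->
    (forall C', C' \in F -> [disjoint S & C']%B -> C \subset C') ->
  v_degree (inter_ideal F) #|S|.
Proof.
move=> FC SC minC; exists 'X_[set_monomial S], (var_ideal C).
have eqC := colon_inter_ideal_monomial FC SC minC; split=> //.
  by rewrite dhomogX; apply/eqP; apply: mdeg_set_monomial.
by split; [exact: var_ideal_prime | exists 'X_[set_monomial S]].
Qed.

(** Some monomial of f is outside the ideal of [C]; take for S its support. Any [C'] disjoint from S
    misses f too, and S has at most as many elements as the degree of that monomial. *)
Lemma v_degree_inter_ideal_ge F u : v_degree (inter_ideal F) u ->
  exists C S, [/\ C \in F, [disjoint S & C]%B,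
    forall C', C' \in F -> [disjoint S & C']%B -> C \subset C' & (#|S| <= u)%N].
Proof.
case=> f [P [fu [pP _] defP]]; rewrite {}defP in pP.
have [C [FC Cf minC]] := prime_colon_inter_ideal pP.
have /existsNP[m /not_implyP[fm mC]] := Cf.
have hitsE C' : hits m C' = ~~ [disjoint [set i | (0 < m i)%N]%SET & C']%B.
  rewrite disjoint_sym disjoint_subset.
  by apply/exists_inP/subsetPn => -[i C'i mi]; exists i; rewrite ?inE ?negbK // in mi *.
exists C, [set i | (0 < m i)%N]%SET; split=> //.
- by apply: contra_notT mC; rewrite hitsE.
- move=> C' FC' mC'; apply: minC => // /(_ m fm).
  by rewrite hitsE mC'.
- have <- : mdeg m = u := dhomog_mf fu fm.
  rewrite mdegE -sum1_card [leqRHS](bigID (fun i => 0 < m i)%N) /=.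
  rewrite (leq_trans _ (leq_addr _ _)) //.
  by rewrite (eq_bigl (fun i => 0 < m i)%N) ?leq_sum // => i; rewrite inE.
Qed.

End InterIdeal.
Arguments inter_ideal : clear implicits.
Arguments inter_ideal K {n} F.

(** * Ideals generated by monomials *)

Section GenIdeal.
Variables (K : fieldType) (n : nat).
Local Notation R := {mpoly K[n]}.

Lemma gen_ideal_sub (A P : set R) : prime_ideal P -> A `<=` P -> gen_ideal A `<=` P.
Proof.
move=> pP AP g [r [rA ->]]; rewrite big_seq; apply: (prime_ideal_sum pP) => t /rA At.
by apply: (prime_idealMl pP); apply: AP.
Qed.

Lemma gen_ideal_msupp (A : set R) g :
    (forall m, m \in msupp g -> exists a s, A s /\ 'X_[m] = a * s) ->
  gen_ideal A g.
Proof.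
rewrite [in gen_ideal _ _](mpolyE g); elim: (msupp g) => [|m r IHr] Ar.
  by exists [::]; rewrite !big_nil.
have [|l [lA El]] := IHr; first by move=> k kr; apply: Ar; rewrite inE kr orbT.
have [|a [s [As Em]]] := Ar m; first exact: mem_head.
exists ((g@_m *: a, s) :: l); split=> [t|]; first by rewrite inE => /orP[/eqP->|/lA].
by rewrite !big_cons El Em scalerAl.
Qed.

Lemma monomial_divX (m : 'X_{1..n}) i : (0 < m i)%N ->
  'X_[m] = 'X_[m - U_(i)] * 'X_i :> R.
Proof. by move=> mi; rewrite -mpolyXD submK // lep1mP -lt0n. Qed.

Lemma gen_ideal_pair (i j : 'I_n) :
  gen_ideal [set 'X_i; 'X_j] = var_ideal K [set i; j]%SET.
Proof.
apply/seteqP; split=> [|g Cg].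
  apply: gen_ideal_sub; first exact: var_ideal_prime.
  by move=> _ [->|->]; apply/var_idealX; rewrite !inE eqxx ?orbT.
apply: gen_ideal_msupp => m /Cg/exists_inP[k]; rewrite !inE => /orP[]/eqP-> mi.
  by exists 'X_[m - U_(i)], 'X_i; split; [left|exact: monomial_divX].
by exists 'X_[m - U_(j)], 'X_j; split; [right|exact: monomial_divX].
Qed.

End GenIdeal.

(** * Edge ideals, cover ideals and minimal vertex covers of a graph *)

Section GraphIdeals.
Variables (K : fieldType) (n : nat) (G : sgraph n).
Implicit Types (C S : {set 'I_n}) (i j : 'I_n).

Definition edges : {set {set 'I_n}} :=
  [set C | [exists i, exists j, G i j && (C == [set i; j])]]%SET.

Lemma edgesP C : reflect (exists i j, G i j /\ C = [set i; j]%SET) (C \in edges).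
Proof.
rewrite inE; apply: (iffP existsP) => [[i /existsP[j /andP[Gij /eqP->]]]|[i [j [Gij ->]]]].
  by exists i, j.
by exists i; apply/existsP; exists j; rewrite Gij eqxx.
Qed.

Lemma cover_ideal_inter : cover_ideal G K = inter_ideal K edges.
Proof.
apply/seteqP; split=> [g Jg C /edgesP[i [j [Gij ->]]]|g Jg i j Gij].
  by rewrite -gen_ideal_pair; apply: Jg.
by rewrite gen_ideal_pair; apply: Jg; apply/edgesP; exists i, j.
Qed.

Lemma edge_ideal_inter :
  edge_ideal G K = inter_ideal K [set C | vertex_cover G C]%SET.
Proof.
apply/seteqP; split=> [g Ig C|g Ig].
  rewrite inE => /forallP coverC; move: g Ig; apply: gen_ideal_sub.
    exact: var_ideal_prime.
  move=> _ [i [j [Gij ->]]]; have /forallP/(_ j) := coverC i; rewrite Gij /=.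
  case/orP => [Ci|Cj]; last by apply/(prime_idealMl (var_ideal_prime _ _))/var_idealX.
  by rewrite mulrC; apply/(prime_idealMl (var_ideal_prime _ _))/var_idealX.
apply: gen_ideal_msupp => m gm.
(* The variables absent from m cannot form a cover, since m would have to involve one of them. Hence
   some edge has both ends in the support of m. *)
have [/Ig/(_ m gm)/exists_inP[i]|] := boolP ([set i | m i == 0%N] \in [set C | vertex_cover G C])%SET.
  by rewrite inE => /eqP->.
rewrite inE => /forallPn[i /forallPn[j]]; rewrite negb_imply negb_or !inE -!lt0n.
case/and3P => Gij mi mj; exists 'X_[m - U_(j) - U_(i)], ('X_i * 'X_j); split.
  by exists i, j.
rewrite (monomial_divX _ mj) mulrA; congr (_ * _); apply: monomial_divX.
rewrite mnmBE mnm1E; case: eqVneq => [eij|_]; last by rewrite subn0.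
by move: Gij; rewrite eij adj_irrefl.
Qed.

Lemma is_bight_edge_ideal b :
  (forall C, minset (vertex_cover G) C -> #|C| = b) -> is_bight (edge_ideal G K) b.
Proof.
move=> cardC; rewrite edge_ideal_inter.
have minE C : minset (mem [set C | vertex_cover G C]%SET) C = minset (vertex_cover G) C.
  by apply: minset_eq => D; rewrite /= inE.
split=> [|P /Ass_inter_ideal[C + ->]]; last first.
  by rewrite minE => /cardC <-; exists #|C| => //; apply: var_ideal_height.
have [|C minC _] := @minset_exists _ (vertex_cover G) setT.
  by apply/forallP => i; apply/forallP => j; rewrite inE implybT.
exists (var_ideal K C); last by rewrite -(cardC C minC); apply: var_ideal_height.
by apply/Ass_inter_ideal; exists C; rewrite // minE.
Qed.

Definition nbhd i : {set 'I_n} := [set j | G i j]%SET.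

Lemma card_nbhdU a b : G a b ->
  #|(nbhd a :|: nbhd b) :\: [set a; b]|%SET = (#|nbhd a :|: nbhd b|%SET - 2)%N.
Proof.
move=> Gab; have Gba : G b a by rewrite adj_sym.
rewrite cardsDS; last first.
  by apply/subsetP => x; rewrite !inE => /orP[]/eqP->; rewrite ?Gab ?Gba ?orbT.
by rewrite cards2; case: eqVneq Gab => // ->; rewrite adj_irrefl.
Qed.

Lemma disjoint_set2 S i j : [disjoint S & [set i; j]%SET]%B = (i \notin S) && (j \notin S).
Proof. by rewrite disjoint_sym disjoints_subset finset.subUset !sub1set !inE. Qed.

(* A monomial whose colon ideal is (x_a, x_b) is supported on a set S that
   misses a and b but meets every other edge, so S contains every other
   neighbour of a or b; this suffices when these neighbours cover all edges. *)
Lemma is_vnumber_cover_ideal a b :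
    G a b -> vertex_cover G (nbhd a :|: nbhd b) ->
    (forall i j, G i j -> (#|nbhd a :|: nbhd b| <= #|nbhd i :|: nbhd j|)%N)%SET ->
  is_vnumber (cover_ideal G K) (#|nbhd a :|: nbhd b|%SET - 2).
Proof.
move=> Gab cov minab; rewrite cover_ideal_inter; split=> [|u].
  (* As the neighbourhoods cover every edge, an edge avoiding the other neighbours has an end equal
     to a or b. Its second end is then a neighbour of a or b, so it is a or b as well. *)
  have sub i j : G i j -> i \notin (nbhd a :|: nbhd b) :\: [set a; b] ->
      j \notin (nbhd a :|: nbhd b) :\: [set a; b] -> i \in [set a; b]%SET.
    move=> Gij; have := Gij; rewrite adj_sym => Gji.
    have /forallP/(_ i)/forallP/(_ j) := cov; rewrite Gij !inE /=.
    case: (eqVneq i a) => //= ia; case: (eqVneq i b) => //= ib.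
    case: (eqVneq j a) Gji => [->->//|ja]; case: (eqVneq j b) => [->->|jb _] /=.
      by rewrite orbT.
    by case/orP=> ->.
  rewrite -card_nbhdU //; apply: (@v_degree_inter_ideal _ _ _ [set a; b]%SET).
  - by apply/edgesP; exists a, b.
  - by rewrite disjoint_set2 !inE !eqxx orbT.
  move=> _ /edgesP[i [j [Gij ->]]]; rewrite disjoint_set2 => /andP[Si Sj].
  suff /eqP-> : [set i; j]%SET == [set a; b]%SET by [].
  rewrite eqEcard finset.subUset !sub1set (sub i j) // (sub j i) 1?adj_sym //=.
  by rewrite !cards2; case: (eqVneq i j) Gij => [->|_ _]; rewrite ?adj_irrefl ?ltnS ?leq_b1.
case/v_degree_inter_ideal_ge => _ [S [/edgesP[i [j [Gij ->]]] Sij minij Su]].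
apply: leq_trans Su; apply: leq_trans (leq_sub2r 2 (minab i j Gij)) _.
move: Sij; rewrite disjoint_set2 => /andP[Si Sj].
rewrite -card_nbhdU //; apply: subset_leq_card; apply/subsetP => k.
rewrite !inE negb_or -andbA => /and3P[ki kj Nk]; apply: contraT => Sk.
have [x [xij Gxk]] : exists x, x \in [set i; j]%SET /\ G x k.
  by case/orP: Nk => ?; [exists i|exists j]; rewrite !inE eqxx ?orbT.
(* If S missed the neighbour k, it would miss the edge xk. The edge ij would then be contained in
   xk, which is impossible because k is neither i nor j. *)
have : [set i; j]%SET \subset [set x; k]%SET.
  apply: minij; first by apply/edgesP; exists x, k.
  by rewrite disjoint_set2 Sk andbT; move: xij; rewrite !inE => /orP[]/eqP->.
rewrite finset.subUset !sub1set !inE ![_ == k]eq_sym (negbTE ki) (negbTE kj) !orbF.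
by case/andP => /eqP ix /eqP jx; rewrite ix jx adj_irrefl in Gij.
Qed.

(** Otherwise all edges at i would be covered by their other ends, and removing i would leave a
    smaller cover. *)
Lemma minset_vertex_cover_nbhd C i :
  minset (vertex_cover G) C -> i \in C -> exists2 j, G i j & j \notin C.
Proof.
case/minsetP => cov minC Ci.
have : ~~ vertex_cover G (C :\ i).
  apply/negP => /minC /(_ (subD1set _ _)) eqC.
  by move: Ci; rewrite -eqC !inE eqxx.
case/forallPn => j /forallPn[k]; rewrite negb_imply negb_or => /andP[Gjk].
rewrite !inE !negb_and !negbK; have /forallP/(_ j)/forallP/(_ k) := cov.
rewrite Gjk /=; case: eqVneq Gjk => [-> Gik|_ Gjk] /=.
  by case: eqVneq Gik => [->|_ Gik _]; [rewrite adj_irrefl|exists k].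
case: eqVneq Gjk => [-> Gji _ /andP[jC _]|_ _]; last by do 2 case: (_ \in C).
by exists j => //; rewrite adj_sym.
Qed.

(* Villarreal's criterion for unmixed bipartite graphs: the perfect matching mu
   meets every minimal vertex cover in exactly one end of each of its edges. *)
Lemma card_min_vertex_cover (mu : 'I_n -> 'I_n) C :
    involutive mu -> (forall i, G i (mu i)) ->
    (forall i j k, G j i -> G (mu i) k -> G j k) ->
  minset (vertex_cover G) C -> (#|C| + #|C|)%N = n.
Proof.
move=> muK Gmu transG minC; have covC := minsetp minC.
have eqC : ~: C = mu @^-1: C.
  apply/setP => i; rewrite !inE; apply/idP/idP => [iC|Cmu].
    by have /forallP/(_ i)/forallP/(_ (mu i)) := covC; rewrite Gmu (negbTE iC).
  (* If both ends of a matching edge were in [C], each would have a neighbour outside [C]; these two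
     neighbours are adjacent by hypothesis, giving an uncovered edge. *)
  apply/negP => /(minset_vertex_cover_nbhd minC)[j Gij jC].
  have [k Gmk kC] := minset_vertex_cover_nbhd minC Cmu.
  have /forallP/(_ j)/forallP/(_ k) := covC.
  by rewrite (transG i) ?(negbTE jC) ?(negbTE kC) // adj_sym.
rewrite -[in X in (_ + X)%N](card_preimset C (inv_inj muK)) -eqC cardsC.
by rewrite card_ord.
Qed.

End GraphIdeals.

(** * The blow-up of the path on four vertices *)

Section PathBlowup.
Variable p : nat.
Hypothesis p_gt0 : (0 < p)%N.
Local Notation V := (bool * bool * 'I_p)%type.

(* The blow-up of a path on four vertices: a vertex is (side, is inner, copy),
   and vertices on opposite sides are adjacent unless both are end vertices. *)
Definition block (i : 'I_#|{: V}|) : bool * bool := (enum_val i).1.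

Definition path_adj (i j : 'I_#|{: V}|) : bool :=
  ((block i).1 != (block j).1) && ((block i).2 || (block j).2).

Lemma path_adj_sym : ssrbool.symmetric path_adj.
Proof. by move=> i j; rewrite /path_adj eq_sym orbC. Qed.

Lemma path_adj_irrefl : irreflexive path_adj.
Proof. by move=> i; rewrite /path_adj eqxx. Qed.

Definition path_blowup := SGraph path_adj_sym path_adj_irrefl.

Lemma exists_block st : exists i, block i = st.
Proof. by exists (enum_rank (st, Ordinal p_gt0)); rewrite /block enum_rankK. Qed.

Lemma card_block st : #|[set i | block i == st]%SET| = p.
Proof.
rewrite (_ : [set i | _]%SET = enum_val @^-1: [set x : V | x.1 == st]%SET); last first.
  by apply/setP => i; rewrite !inE.
rewrite on_card_preimset; last exact/onW_bij/enum_val_bij.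
rewrite (_ : [set x | _]%SET = finset.setX [set st]%SET setT); last first.
  by apply/setP => x; rewrite !inE andbT.
by rewrite cardsX cards1 cardsT card_ord mul1n.
Qed.

Lemma card_path_blowup : #|{: V}| = (4 * p)%N.
Proof. by rewrite !card_prod card_bool card_ord. Qed.

(** Each end block is matched, copy by copy, with the inner block next to it. *)
Definition matching (i : 'I_#|{: V}|) : 'I_#|{: V}| :=
  enum_rank (~~ (block i).1, ~~ (block i).2, (enum_val i).2).

Lemma block_matching i : block (matching i) = (~~ (block i).1, ~~ (block i).2).
Proof. by rewrite {1}/block enum_rankK. Qed.

Lemma matchingK : involutive matching.
Proof.
move=> i; rewrite {1}/matching block_matching /= !negbK enum_rankK /block.
by rewrite -!surjective_pairing enum_valK.
Qed.

Lemma card_min_vertex_cover_path_blowup C :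
  minset (vertex_cover path_blowup) C -> #|C| = (2 * p)%N.
Proof.
move=> minC; have : (#|C| + #|C|)%N = (4 * p)%N.
  rewrite -card_path_blowup; apply: (card_min_vertex_cover matchingK _ _ minC).
  - by move=> i; rewrite /= /path_adj block_matching; case: (block i) => [[] []].
  - move=> i j k; rewrite /= /path_adj block_matching.
    by case: (block i) (block j) (block k) => [[] []] [[] []] [[] []].
by rewrite addnn -mul2n -[4%N]/(2 * 2)%N -mulnA => /eqP; rewrite eqn_pmul2l // => /eqP.
Qed.

Lemma bipartite_path_blowup : bipartite path_blowup.
Proof.
exists [set i | (block i).1]%SET => i j; rewrite !inE /= /path_adj.
by case/andP => +  _; apply: contraNneq => ->.
Qed.

(** Non-adjacency is transitive in a complete multipartite graph. Here an end block is adjacent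
    neither to the other end block nor to the inner block on its own side, yet those two are
    adjacent. *)
Lemma path_blowup_not_complete_multipartite : ~ complete_multipartite path_blowup.
Proof.
case=> P [/and3P[/eqP coverP trivP _] _ adjP].
have inP i : exists2 A, A \in P & i \in A.
  by apply/bigcupP; rewrite -/(cover P) coverP inE.
have same i j A B : ~~ path_adj i j -> A \in P -> B \in P -> i \in A -> j \in B -> A = B.
  move=> nij PA PB Ai Bj; apply/eqP; apply: contraNT nij => AB.
  by apply/(adjP i j).2; exists A, B.
have [i bi] := exists_block (false, false).
have [j bj] := exists_block (true, false).
have [k bk] := exists_block (false, true).
have [A PA Ai] := inP i; have [B PB Bj] := inP j; have [D PD Dk] := inP k.
have AB : A = B by apply: same Ai Bj; rewrite // /path_adj bi bj.
have AD : A = D by apply: same Ai Dk; rewrite // /path_adj bi bk.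
have /(adjP j k).1[B' [D' []]] : path_adj j k by rewrite /path_adj bj bk.
move=> PB' PD' + B'j D'k; rewrite -(def_pblock trivP PB' B'j) -(def_pblock trivP PD' D'k).
by rewrite (def_pblock trivP PB Bj) (def_pblock trivP PD Dk) -AB AD eqxx.
Qed.

Lemma is_vnumber_path_blowup (K : fieldType) :
  is_vnumber (cover_ideal path_blowup K) (3 * p - 2).
Proof.
have [a ba] := exists_block (false, false).
have [b bb] := exists_block (true, true).
have card_notblock st : #|~: [set i | block i == st]|%SET = (3 * p)%N.
  by apply/eqP; rewrite -(eqn_add2l p) -{1}(card_block st) cardsC card_ord card_path_blowup.
have eqN : nbhd path_blowup a :|: nbhd path_blowup b =
           ~: [set i | block i == (true, false)]%SET.
  apply/setP => i; rewrite !inE /= /path_adj ba bb.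
  by case: (block i) => [[] []].
rewrite -(card_notblock (true, false)) -eqN; apply: is_vnumber_cover_ideal.
- by rewrite /= /path_adj ba bb.
- apply/forallP => i; apply/forallP => j; rewrite eqN !inE /= /path_adj.
  by case: (block i) (block j) => [[] []] [[] []].
move=> i j /andP[sij tij]; rewrite eqN card_notblock.
(* An inner end of the edge ij sees the whole opposite side, and the other end sees at least the
   inner block on the side of the first. Only the end block on that side can be missed. *)
rewrite -(card_notblock (if (block i).2 then (block i).1 else (block j).1, false)).
apply: subset_leq_card; apply/subsetP => k; rewrite !inE /= /path_adj.
by move: sij tij; case: (block i) (block j) (block k) => [[] []] [[] []] [[] []].
Qed.

End PathBlowup.

Theorem corollary1p4 (K : fieldType) (p : nat) (hp : (2 <= p)%N) :
  exists (u : nat) (H : sgraph u),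
    [/\ unmixed H, bipartite H, ~ complete_multipartite H
      & exists v b : nat,
          [/\ is_vnumber (cover_ideal H K) v,
              is_bight (edge_ideal H K) b,
              (v%:Z - b%:Z = p%:Z - 2)%R
            & (b <= v)%N]].
Proof.
have p_gt0 : (0 < p)%N by apply: ltnW.
have cardC := @card_min_vertex_cover_path_blowup p.
exists #|{: bool * bool * 'I_p}|, (path_blowup p); split.
- by move=> C D /cardC-> /cardC->.
- exact: bipartite_path_blowup.
- exact: path_blowup_not_complete_multipartite.
(* This makes the truncated subtraction 3p - 2 agree with the one in the integers. *)
have le2 : (2 <= 3 * p)%N by rewrite (leq_trans hp) // leq_pmull.
exists (3 * p - 2)%N, (2 * p)%N; split.
- exact: is_vnumber_path_blowup.
- exact: is_bight_edge_ideal cardC.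
- by rewrite -subzn // mulSn PoszD [RHS]addrC addrAC addrK addrC.
- by rewrite [(3 * p)%N]mulSn addnC -addnBA // leq_addr.
Qed.
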